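(* Let $n\ge 1$ and $m$ be integers with $m\ge 2n^2$, and let $G=P_n\square P_m$. Then $\mathrm{Z}_{(1)}(G)=2n$.
   Context: $P_k$ is the path on $k$ vertices and $P_n\square P_m$ is the Cartesian product (rectangular grid graph): its vertices are $(x,y)$ with $1\le x\le n$, $1\le y\le m$, and $(x,y),(a,b)$ are adjacent if and only if ($x=a$ and $|y-b|=1$) or ($y=b$ and $|x-a|=1$). Zero forcing color change rule: a blue vertex $u$ may force (color blue) a white vertex $v$ if $v$ is the only white neighbor of $u$. A leak is a vertex that is not allowed to perform a force. A set $B\subseteq V(G)$ is a $1$-leaky forcing set of a graph $G$ if for every choice of a single vertex as a leak, starting with exactly $B$ blue (all others white) and iteratively applying the color change rule, with the leak not allowed to force, eventually colors all of $V(G)$ blue. $\mathrm{Z}_{(1)}(G)$ is the minimum size of a $1$-leaky forcing set of $G$. *)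

(* Defs.v *)
From mathcomp Require Import all_boot.

Set Implicit Arguments.
Unset Strict Implicit.
Unset Printing Implicit Defensive.

(* A finite simple graph is given by its adjacency relation, a symmetric and
   irreflexive [rel T] on a [finType] of vertices. *)

Section LeakyForcing.

Variables (T : finType) (e : rel T).

Definition white_neighbors (B : {set T}) (u : T) : {set T} :=
  [set w | e u w & w \notin B].

Definition force_step (leak : T) : rel {set T} := fun B B' =>
  [exists u, exists v,
    [&& u \in B, u != leak, white_neighbors B u == [set v] & B' == v |: B]].

Definition leaky1_forcing_set (B : {set T}) : bool :=
  [forall leak, connect (force_step leak) B [set: T]].

Lemma leaky1_forcing_setT : leaky1_forcing_set [set: T].
Proof. by apply/forallP => leak; apply: connect0. Qed.

(* The minimum is genuine, as [set: T] is a leaky forcing set by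
   [leaky1_forcing_setT]. *)
Definition leaky1_number : nat :=
  #|[arg min_(B < [set: T] | leaky1_forcing_set B) #|B|]|.

Lemma leaky1_number_attained :
  exists2 B : {set T}, leaky1_forcing_set B & #|B| = leaky1_number.
Proof.
rewrite /leaky1_number; case: arg_minnP => [|B HB _].
  exact: leaky1_forcing_setT.
by exists B.
Qed.

Lemma leaky1_number_le (B : {set T}) :
  leaky1_forcing_set B -> leaky1_number <= #|B|.
Proof.
rewrite /leaky1_number; case: arg_minnP => [|A _ minA].
  exact: leaky1_forcing_setT.
exact: minA.
Qed.

End LeakyForcing.

(* The vertices of the path are 0, ..., k - 1 rather than 1, ..., k. *)
Definition path_graph (k : nat) : rel 'I_k :=
  fun i j => (i.+1 == j :> nat) || (j.+1 == i :> nat).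

Definition cart_prod (T1 T2 : finType) (e1 : rel T1) (e2 : rel T2) :
    rel (T1 * T2)%type :=
  fun u v => ((u.1 == v.1) && e2 u.2 v.2) || ((u.2 == v.2) && e1 u.1 v.1).

Lemma path_graph_sym k : symmetric (@path_graph k).
Proof. by move=> i j; rewrite /path_graph orbC. Qed.

Lemma path_graph_irrefl k : irreflexive (@path_graph k).
Proof. by move=> i; rewrite /path_graph orbb; apply/negbTE; rewrite gtn_eqF. Qed.

Lemma cart_prod_sym (T1 T2 : finType) (e1 : rel T1) (e2 : rel T2) :
  symmetric e1 -> symmetric e2 -> symmetric (cart_prod e1 e2).
Proof.
move=> s1 s2 u v.
by rewrite /cart_prod s1 s2 (eq_sym u.1) (eq_sym u.2).
Qed.

Lemma cart_prod_irrefl (T1 T2 : finType) (e1 : rel T1) (e2 : rel T2) :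
  irreflexive e1 -> irreflexive e2 -> irreflexive (cart_prod e1 e2).
Proof. by move=> i1 i2 u; rewrite /cart_prod i1 i2 !andbF. Qed.

(* Main.v *)
Require Import Defs.
From mathcomp Require Import all_boot.
From mathcomp Require Import zify.

Set Implicit Arguments.
Unset Strict Implicit.
Unset Printing Implicit Defensive.

(* Upper bound: the first and the last column force the grid from both ends, and
   the two sweeps meet at the column of the leak.

   Lower bound: a set B of fewer than 2n vertices misses n consecutive columns
   a, ..., a + n - 1, and by symmetry fewer than n of its vertices lie to the
   left of column a.  A force does not increase the number of blue vertices
   with a white neighbor, so these vertices, forcing on their own without any
   leak, never get n such vertices; as the far right stays white, some row r
   stays entirely white, and with it the cone of the vertices (i, j) with
   j >= a and j + 1 >= a + |i - r|.  Let p be the mirror image of row r.  The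
   vertices that stay white and satisfy j + |i - p| < a + n form a nonempty set
   F that avoids B; since |i - p| + |i - r| < n, the oblique sides of F lie
   inside the cone, so that the apex (p, a + n) is the only vertex outside F
   with exactly one neighbor in F.  With a leak there, F is never entered. *)

(** * Forts and boundaries in an arbitrary graph *)

Section Forcing.

Variables (T : finType) (e : rel T).
Implicit Types (B X F : {set T}) (u v w : T).

(** A fort in the sense of zero forcing, except that the ban on having exactly one neighbor in [F]
    is waived at a single outside vertex. *)
Definition leaky1_fort F := exists leak, forall u v,
  u \notin F -> u != leak -> v \in F -> e u v ->
  exists2 w, w \in F & e u w && (w != v).

Lemma white_neighbors1P X u v : white_neighbors e X u = [set v] ->
  [/\ e u v, v \notin X & forall w, e u w -> w \notin X -> w = v].
Proof.
move=> /setP eqX; move: (eqX v); rewrite !inE eqxx => /andP[euv vX].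
by split=> // w euw wX; apply/set1P; rewrite -eqX inE euw.
Qed.

(** The first force into [F] would come from a vertex outside [F] other than the leak; that vertex
    has a second neighbor in [F], which is still white. *)
Lemma leaky1_forcing_meets_fort B F x :
  leaky1_forcing_set e B -> leaky1_fort F -> x \in F -> ~~ [disjoint B & F].
Proof.
move=> /forallP forceB [leak fortF] xF; apply/negP => dis0.
have [p stepP eqT] := connectP (forceB leak).
elim: p B dis0 stepP eqT {forceB} => [|X p IHp] B disB /= => [_ BT|].
  by move: disB; rewrite -BT => /disjointFr/(_ (in_setT x)); rewrite xF.
case/andP=> /existsP[u /existsP[v /and4P[uB uleak /eqP wnB /eqP ->]]].
apply: IHp; have [euv _ uniq_v] := white_neighbors1P wnB.
have vF : v \notin F.
  apply/negP => vF; have uF := disjointFr disB uB.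
  have [|w wF /andP[euw]] := fortF u v _ uleak vF euv; first by rewrite uF.
  by rewrite (uniq_v w) ?eqxx // (disjointFl disB wF).
rewrite -setI_eq0 setIUl setU_eq0 !setI_eq0 disB andbT.
by rewrite disjoints1.
Qed.

Lemma connect_force_step B leak :
  (forall X, B \subset X -> X != setT ->
    exists u v, [/\ u \in X, u != leak & white_neighbors e X u = [set v]]) ->
  connect (force_step e leak) B setT.
Proof.
move=> progress; have [k] := ubnP #|~: B|.
elim: k B progress => // k IHk B progress leBk.
have [->|nT] := eqVneq B setT; first exact: connect0.
have [u [v [uB ul wn]]] := progress B (subxx _) nT.
have [_ vB _] := white_neighbors1P wn.
apply: (connect_trans (y := v |: B)).
  apply: connect1; apply/existsP; exists u; apply/existsP; exists v.
  by rewrite uB ul wn !eqxx.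
apply: IHk => [X sX|].
  by apply: progress; apply: subset_trans sX; apply: subsetUr.
rewrite -ltnS; apply: leq_trans leBk; rewrite ltnS.
by apply: proper_card; rewrite properC properEcard subsetUr cardsU1 vB /=.
Qed.

Definition boundary X := [set u in X | [exists v, e u v && (v \notin X)]].

(** [u] leaves the boundary, since [v] was its last white neighbor, and only [v] can enter it. *)
Lemma card_boundary_force X u v : u \in X ->
  white_neighbors e X u = [set v] -> #|boundary (v |: X)| <= #|boundary X|.
Proof.
move=> uX /white_neighbors1P[euv vX uniq_v].
have ubX : u \in boundary X.
  by rewrite inE uX; apply/existsP; exists v; rewrite euv.
rewrite (cardsD1 u (boundary X)) ubX.
apply: leq_trans (_ : #|v |: (boundary X :\ u)| <= _); last first.
  by rewrite cardsU1 leq_add2r leq_b1.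
apply/subset_leq_card/subsetP => w; rewrite !inE.
case/andP=> wvX /existsP[z /andP[ewz]]; rewrite !inE negb_or => /andP[zv zX].
have [//|wv /=] := eqVneq w v; move: wvX; rewrite (negbTE wv) /= => wX.
rewrite wX; apply/andP; split.
  by apply/eqP => wu; rewrite wu in ewz; rewrite (uniq_v z) ?eqxx in zv.
by apply/existsP; exists z; rewrite ewz.
Qed.

End Forcing.

(** * Grid coordinates and the upper bound *)

Section Grid.

Variables n m : nat.
Notation V := ('I_n * 'I_m)%type.
Notation grid := (cart_prod (@path_graph n) (@path_graph m)).
Implicit Types (B X F : {set V}) (u v w : V) (r : 'I_n).

(** With truncated subtraction one summand is zero, so this is |x - y|. *)
Definition dist x y := (x - y) + (y - x).

Lemma dist_step x y k : x < k -> y < k -> x != y ->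
  exists z, [/\ z < k, dist x y = (dist z y).+1 & (x.+1 == z) || (z.+1 == x)].
Proof.
rewrite /dist => xk yk; case: ltngtP => // xy _.
  by exists x.+1; split; lia.
by exists x.-1; split; lia.
Qed.

Lemma gridE u v : grid u v =
  (u.1 == v.1 :> nat) && ((u.2.+1 == v.2) || (v.2.+1 == u.2)) ||
  (u.2 == v.2 :> nat) && ((u.1.+1 == v.1) || (v.1.+1 == u.1)).
Proof. by []. Qed.

Lemma vertex_eq u v : u.1 = v.1 :> nat -> u.2 = v.2 :> nat -> u = v.
Proof.
by case: u v => [? ?] [? ?] /= h1 h2; congr (_, _); apply: val_inj.
Qed.

Lemma vertex_exists x y : x < n -> y < m ->
  exists v : V, v.1 = x :> nat /\ v.2 = y :> nat.
Proof. by move=> hx hy; exists (Ordinal hx, Ordinal hy). Qed.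

Lemma vertex_max (P : pred V) (f : V -> nat) v0 : P v0 ->
  exists2 v, P v & forall w, P w -> f w <= f v.
Proof. by move=> Pv0; case: (arg_maxnP f Pv0) => v Pv v_max; exists v. Qed.

Lemma end_columns_leaky1_forcing : 1 < m ->
  leaky1_forcing_set grid [set v : V | (v.2 == 0 :> nat) || (v.2.+1 == m)].
Proof.
move=> m_gt1; set E := [set v | _].
suff forceE (leak : V) : connect (force_step grid leak) E setT by exact/forallP.
apply: connect_force_step => X sBX nT.
have endX v : (v.2 == 0 :> nat) || (v.2.+1 == m) -> v \in X.
  by move=> hv; apply: (subsetP sBX); rewrite inE.
have [w0 w0X] : exists w : V, w \notin X.
  apply/existsP; apply: contraNT nT => /existsPn allX; apply/eqP/setP => v.
  by rewrite inE; apply/negPn/allX.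
(* Maximizing [m - w.2] makes [w] a leftmost white vertex; [w'] is a rightmost one. If [w] is not
   beyond the column of the leak, its left neighbor forces it; otherwise the right neighbor of [w']
   forces [w']. *)
have [w /= wX w_min] := @vertex_max [pred w | w \notin X] (fun w => m - w.2) w0 w0X.
have [w' /= w'X w'_max] := @vertex_max [pred w | w \notin X] (fun w => w.2) w0 w0X.
have w_lt := ltn_ord w.2; have w'_lt := ltn_ord w'.2.
have [w_leak|leak_w] := leqP w.2 leak.2.
  have w_gt0 : 0 < w.2.
    by rewrite lt0n; apply: contra wX => w2; apply: endX; rewrite w2.
  have [|u [u1 u2]] := @vertex_exists w.1 w.2.-1 (ltn_ord _); first lia.
  exists u, w; split.
  - by apply: contraT => /w_min /=; rewrite u2; lia.
  - by apply/eqP => eu; rewrite -eu in w_leak; lia.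
  apply/setP => z; rewrite !inE gridE; apply/idP/eqP => [/andP[uz /w_min /= wz]|->].
    by apply: vertex_eq; lia.
  by rewrite wX andbT; lia.
have w'_ltm : w'.2.+1 < m.
  rewrite ltn_neqAle w'_lt andbT; apply: contra w'X => h.
  by apply: endX; rewrite h orbT.
have [u [u1 u2]] := vertex_exists (ltn_ord w'.1) w'_ltm.
have leak_w' : leak.2 < w'.2 by apply: leq_trans leak_w _; exact: w'_max.
exists u, w'; split.
- by apply: contraT => /w'_max; rewrite u2 /=; lia.
- by apply/eqP => eu; rewrite -eu in leak_w'; lia.
apply/setP => z; rewrite !inE gridE; apply/idP/eqP => [/andP[uz /w'_max /= wz]|->].
  by apply: vertex_eq; lia.
by rewrite w'X andbT; lia.
Qed.

Lemma card_end_columns :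
  #|[set v : V | (v.2 == 0 :> nat) || (v.2.+1 == m)]| <= 2 * n.
Proof.
set E := [set _ | _].
have injE : {in E &, injective (fun v : V => (v.1, v.2 == 0 :> nat))}.
  move=> u v; rewrite !inE => hu hv [uv1 uv2].
  by apply: vertex_eq; [rewrite uv1|lia].
rewrite -(card_in_imset injE); apply: leq_trans (max_card _) _.
by rewrite card_prod card_ord card_bool mulnC.
Qed.

(** * Lower bound: forcing from the left of column [a] *)

Section LeftForcing.

Variable a : nat.
Hypothesis le_an_m : a + n <= m.

Definition cone r v := (a <= v.2) && (a + dist v.1 r <= v.2.+1).

Definition white_row X r := [forall v : V, (v.1 == r) ==> (v \notin X)].

Lemma white_rowP X r :
  reflect (forall v, v.1 = r -> v \notin X) (white_row X r).
Proof.
apply: (iffP forallP) => [h v vr|h v]; first by move: (h v); rewrite vr eqxx.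
by apply/implyP => /eqP; apply: h.
Qed.

(** The invariant of forcing from the left. The cone condition ranges over all white rows because a
    force may spoil one of them, and the argument then continues with another. *)
Definition confined X :=
  [&& #|boundary grid X| < n, [exists r, white_row X r] &
      [forall r, white_row X r ==> [forall v, cone r v ==> (v \notin X)]]].

Lemma confinedP X : reflect
  [/\ #|boundary grid X| < n, exists r, white_row X r &
      forall r v, white_row X r -> cone r v -> v \notin X]
  (confined X).
Proof.
apply: (iffP and3P) => [[h1 /existsP h2 /forallP h3]|[h1 h2 h3]]; split => //.
- by move=> r v hr hv; move/implyP: (h3 r) => /(_ hr)/forallP/(_ v)/implyP; apply.
- exact/existsP.
- apply/forallP => r; apply/implyP => hr; apply/forallP => v; apply/implyP.
  exact: h3.
Qed.

(** The rightmost vertex of [X] in each row has a white right neighbor. *)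
Lemma all_rows_card_boundary X :
  (forall r, ~~ white_row X r) -> {in X, forall v, v.2.+1 < m} ->
  n <= #|boundary grid X|.
Proof.
move=> rows X_lt; rewrite -[X in X <= _]card_ord -cardsT.
apply: leq_trans (leq_imset_card fst _).
apply/subset_leq_card/subsetP => r _.
have /forallPn[v0] := rows r; rewrite negb_imply negbK => v0r.
have [v /= /andP[vr vX] v_max] :=
  @vertex_max [pred v : V | (v.1 == r) && (v \in X)] (fun v => v.2) v0 v0r.
apply/imsetP; exists v; last by rewrite (eqP vr).
rewrite inE vX; apply/existsP.
have [w [w1 w2]] := vertex_exists (ltn_ord v.1) (X_lt v vX).
exists w; rewrite gridE w1 w2 !eqxx /=.
apply/negP => wX; have := v_max w; rewrite /= wX -val_eqE /= w1 (eqP vr) eqxx w2.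
by move/(_ isT); lia.
Qed.

Lemma confined_left B :
  B \subset [set v : V | v.2 < a] -> #|B| < n -> confined B.
Proof.
move=> sB ltBn; apply/confinedP; split.
- apply: leq_ltn_trans ltBn; apply/subset_leq_card/subsetP => v.
  by rewrite inE => /andP[].
- have : #|fst @: B| < #|[set: 'I_n]|.
    by rewrite cardsT card_ord; apply: leq_ltn_trans (leq_imset_card _ _) ltBn.
  rewrite ltnNge => /(contra (@subset_leq_card _ _ _)) /subsetPn[r _ rB].
  exists r; apply/white_rowP => v vr; apply: contra rB => vB.
  by rewrite -vr imset_f.
- move=> r v _ /andP[av _]; apply/negP => /(subsetP sB); rewrite inE; lia.
Qed.

Lemma confined_force X u v : confined X -> u \in X ->
  white_neighbors grid X u = [set v] -> confined (v |: X).
Proof.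
case/confinedP=> bX [r0 r0X] coneX uX wn.
have [euv vX uniq_v] := white_neighbors1P wn.
have rowU r : white_row (v |: X) r -> white_row X r /\ v.1 != r.
  move/white_rowP => hr; split.
    by apply/white_rowP => w /hr; rewrite !inE negb_or => /andP[].
  by apply/eqP => /hr; rewrite !inE eqxx.
have bvX : #|boundary grid (v |: X)| < n.
  exact: leq_ltn_trans (card_boundary_force uX wn) bX.
have u1 := ltn_ord u.1; have u2 := ltn_ord u.2.
have v1 := ltn_ord v.1; have v2 := ltn_ord v.2.
apply/confinedP; split=> //.
  apply/existsP; apply: contraLR bvX => /existsPn rows.
  rewrite -leqNgt; apply: all_rows_card_boundary => // w.
  (* The cone of [r0] contains every column from [a + n - 1] on. *)
  have X_lt (z : V) : z \in X -> z.2.+1 < a + n.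
    move=> zX; rewrite ltnNge; apply/negP => hz.
    have := coneX r0 z r0X; rewrite zX /cone /dist.
    by have := ltn_ord z.1; have := ltn_ord r0; lia.
  rewrite !inE => /orP[/eqP->|/X_lt]; last by lia.
  (* Only [v] can have spoiled row [r0]; it was forced from another row, so it lies in the column of
     [u], where [X_lt] applies. *)
  have vr0 : v.1 = r0.
    apply/eqP; have /forallPn[z] := rows r0; rewrite negb_imply negbK !inE.
    case/andP=> /eqP zr0 /orP[/eqP<-|zX]; first exact/eqP.
    by move/white_rowP: r0X => /(_ _ zr0); rewrite zX.
  have ur0 : u.1 != r0.
    by apply/eqP => /(white_rowP _ _ r0X); rewrite uX.
  move: ur0 (X_lt u uX) euv; rewrite -vr0 -val_eqE gridE /=; lia.
move=> r w /rowU[rX vr]; rewrite !inE negb_or => cw.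
rewrite (coneX r w) // andbT; apply/eqP => wv; rewrite {w}wv in cw.
have ur : u.1 != r by apply/eqP => /(white_rowP _ _ rX); rewrite uX.
have nu : ~~ cone r u by apply: contraTN uX => /(coneX _ _ rX).
have hr := ltn_ord r.
(* [u] has two white neighbors: the one towards row [r] and the one on its right
   both lie in the cone or in row [r]. *)
have [x [xn dx ux]] := dist_step u1 hr ur.
have [t [t1 t2]] := vertex_exists xn u2.
have eut : grid u t by rewrite gridE t1 t2 ux eqxx orbT.
have [tr|tr] := eqVneq t.1 r.
  by have := uniq_v t eut (white_rowP _ _ rX _ tr) => tv; rewrite -tv tr eqxx in vr.
move: nu cw euv vr tr; rewrite /cone gridE -!val_eqE /= t1 => nu cw euv vr tr.
have dt : a + dist t.1 r <= u.2.+1.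
  by rewrite t1; move: nu cw euv dx; rewrite /dist; lia.
have av : a <= u.2 by move: nu cw euv tr dx ux; rewrite /dist; lia.
have tv : t = v by apply: uniq_v => //; apply: (coneX r _ rX); rewrite /cone t2 av.
have [|s [s1 s2]] := @vertex_exists u.1 u.2.+1 u1.
  by move: nu; rewrite /dist; lia.
have sv : s = v.
  apply: uniq_v; first by rewrite gridE s1 s2 !eqxx.
  by apply: (coneX r _ rX); rewrite /cone s1 s2 dx -t1; lia.
by move: t2 s2; rewrite tv sv; lia.
Qed.

Lemma left_leaky1_fort B : #|B :&: [set v : V | v.2 < a]| < n ->
  (forall v : V, v \in B -> ~~ (a <= v.2 < a + n)) ->
  exists F, [/\ leaky1_fort grid F, F != set0 & [disjoint B & F]].
Proof.
move=> ltBn gapB; set L := B :&: _ in ltBn.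
have cL : confined L by apply: confined_left => //; apply: subsetIr.
(* By maximality, the largest such [X] admits no further force, even without a leak. *)
pose good := [pred X | confined X && (L \subset X)].
have [|X /andP[cX sLX] X_max] := @arg_maxnP _ L good (fun X => #|X|).
  by rewrite /= cL subxx.
have stalled u v : u \in X -> white_neighbors grid X u != [set v].
  move=> uX; apply/eqP => wn; have [_ vX _] := white_neighbors1P wn.
  have : good (v |: X).
    by rewrite /= (confined_force cX uX wn) (subset_trans sLX) ?subsetUr.
  by move/X_max; rewrite cardsU1 vX; lia.
have /confinedP[_ [r rX] /(_ r _ rX) coneX] := cX.
have hr := ltn_ord r.
pose D v := v.2 + dist v.1 (rev_ord r) < a + n.
pose F := [set v | (v \notin X) && D v].
exists F; split; last first.
- rewrite disjoint_subset; apply/subsetP => v vB; rewrite !inE negb_and negbK.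
  have [va|av] := ltnP (v : V).2 a; first by rewrite (subsetP sLX) // !inE vB.
  by apply/orP; right; move: (gapB v vB); rewrite /D; lia.
(* The first vertex of the white row [r] lies in [F] because |r - p| < n. *)
- apply/set0Pn; have [|v [v1 v2]] := @vertex_exists r 0 hr; first by lia.
  exists v; rewrite inE (white_rowP _ _ rX) /D /dist ?v1 ?v2 /=; first lia.
  exact: val_inj.
(* If [a + n = m], the apex is outside the grid and the leak is irrelevant. *)
have leakP : minn (a + n) m.-1 < m by lia.
pose leak := (rev_ord r, Ordinal leakP).
suff fortF (u v : V) : u \notin F -> u != leak -> v \in F -> grid u v ->
    exists2 w : V, w \in F & grid u w && (w != v).
  by exists leak.
rewrite !inE negb_and negbK.
have u1 := ltn_ord u.1; have u2 := ltn_ord u.2.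
have v1 := ltn_ord v.1; have v2 := ltn_ord v.2.
have [uX _ _ /andP[vX vD] euv|uX /= nDu uleak /andP[vX vD] euv] := boolP (u \in X).
  (* As [X] is stalled, a blue [u] has another white neighbor; as [u] is outside the cone, that
     neighbor satisfies [D]. *)
  have [w euw wv] : exists2 w : V, grid u w && (w \notin X) & w != v.
    apply/exists_inP; apply: contraR (stalled u v uX) => /exists_inPn one.
    apply/eqP/setP => w; rewrite !inE; apply/idP/eqP => [/one|->].
      by rewrite negbK => /eqP.
    by rewrite euv.
  case/andP: euw => euw wX; exists w; last by rewrite euw.
  rewrite inE wX /=; have /(contraL (coneX u)) := uX.
  have w1 := ltn_ord w.1.
  by move: euw; rewrite gridE /cone /D /dist /=; lia.
have nur : u.1 != rev_ord r.
  apply: contraNneq uleak => ur; apply/eqP/vertex_eq; rewrite ?ur //=.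
  by move: nDu vD euv; rewrite gridE /D /dist ur /=; lia.
move: nur nDu vD euv; rewrite -val_eqE /D /dist gridE /= => nur nDu vD euv.
(* The oblique sides of [F] lie in the cone, hence are white. *)
have inF (w : V) : a + n = w.2 + dist w.1 (rev_ord r) + 1 -> w \in F.
  move=> hw; rewrite inE coneX ?/D; first lia.
  by have := ltn_ord w.1; move: hw; rewrite /cone /dist /=; lia.
(* [u] is one step beyond an oblique side, so its left neighbor [s] and its neighbor [t] towards row
   p are both in [F], and one of them is not [v]. *)
have [|s [s1 s2]] := @vertex_exists u.1 u.2.-1 u1; first by lia.
have [x [xn dx ux]] := dist_step u1 (ltn_ord (rev_ord r)) nur.
have [t [t1 t2]] := vertex_exists xn u2.
have [sv|sv] := eqVneq s v.
  exists t.
    by apply: inF; rewrite t1 t2; move: dx nDu vD euv; rewrite /dist /=; lia.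
  apply/andP; split; first by rewrite gridE t1 t2 ux eqxx orbT.
  apply/eqP => tv; move: s1 t1; rewrite sv tv => ->; lia.
exists s.
  by apply: inF; rewrite s1 s2; move: dx nDu vD euv; rewrite /dist /=; lia.
rewrite sv gridE s1 s2; lia.
Qed.

End LeftForcing.

(** * Lower bound: reflection and counting *)

Definition flip v : V := (v.1, rev_ord v.2).

Lemma flipK : involutive flip.
Proof. by case=> x y; rewrite /flip rev_ordK. Qed.

Lemma grid_flip u v : grid (flip u) (flip v) = grid u v.
Proof.
have := ltn_ord u.2; have := ltn_ord v.2.
by rewrite !gridE /=; lia.
Qed.

Lemma leaky1_fort_flip F :
  leaky1_fort grid F -> leaky1_fort grid (flip @^-1: F).
Proof.
case=> leak fortF; exists (flip leak) => u v; rewrite !inE => uF ul vF euv.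
have [||w wF /andP[euw wv]] := fortF (flip u) (flip v) uF _ vF.
- by apply: contraNneq ul => <-; rewrite flipK.
- by rewrite grid_flip.
exists (flip w); first by rewrite inE flipK.
rewrite -grid_flip flipK euw; apply: contraNneq wv => <-.
by rewrite flipK.
Qed.

Lemma empty_columns B : 2 * n ^ 2 <= m -> #|B| < 2 * n ->
  exists2 a, a + n <= m & forall v : V, v \in B -> ~~ (a <= v.2 < a + n).
Proof.
move=> hm ltB; have n_gt0 : 0 < n by lia.
(* The first 2n^2 columns form 2n blocks of width [n], too many for [B] to meet them all; later
   columns go to [None]. *)
pose block (v : V) : option 'I_(2 * n) := insub (v.2 %/ n).
have : #|block @: B| < #|[set Some k | k : 'I_(2 * n)]|.
  rewrite [X in _ < X]card_imset ?card_ord; last exact: Some_inj.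
  exact: leq_ltn_trans (leq_imset_card _ _) ltB.
rewrite ltnNge => /(contra (@subset_leq_card _ _ _))/subsetPn[_ /imsetP[k _ ->]].
move=> kB; have := ltn_ord k => hk; exists (k * n); first by nia.
move=> v vB; apply: contra kB => /andP[le_v lt_v].
have v_k : v.2 %/ n = k.
  by apply/eqP; rewrite eqn_leq -ltnS ltn_divLR // leq_divRL // mulSn addnC lt_v.
by apply/imsetP; exists v => //; rewrite /block v_k valK.
Qed.

Lemma leaky1_forcing_card_ge B : 2 * n ^ 2 <= m ->
  leaky1_forcing_set grid B -> 2 * n <= #|B|.
Proof.
move=> hm forceB; rewrite leqNgt; apply/negP => ltB.
have no_fort F : leaky1_fort grid F -> F != set0 -> ~~ [disjoint B & F].
  by move=> fF /set0Pn[x xF]; apply: leaky1_forcing_meets_fort forceB fF xF.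
have [a le_an gapB] := empty_columns hm ltB.
pose L := [set v : V | v.2 < a].
have [ltL|geL] := ltnP #|B :&: L| n.
  have [F [fF F0 dF]] := left_leaky1_fort le_an ltL gapB.
  by have := no_fort F fF F0; rewrite dF.
(* The reflected gap starts at [a'], the image of column [a + n - 1]. *)
pose a' := m - (a + n); have le_an' : a' + n <= m by lia.
have ltR : #|(flip @^-1: B) :&: [set v : V | v.2 < a']| < n.
  rewrite -(card_imset _ (inv_inj flipK)).
  apply: leq_ltn_trans (_ : #|B :\: L| < n); last first.
    rewrite -(ltn_add2l n) addnn -mul2n; apply: leq_ltn_trans ltB.
    by rewrite -(cardsID L B) leq_add2r.
  apply/subset_leq_card/subsetP => _ /imsetP[v vB ->]; move: vB.
  rewrite !inE => /andP[-> /= lt_v]; rewrite andbT -leqNgt.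
  by move: lt_v; rewrite /a'; lia.
have gapB' (v : V) : v \in flip @^-1: B -> ~~ (a' <= v.2 < a' + n).
  rewrite inE => /gapB /=; have := ltn_ord v.2; rewrite /a'; lia.
have [F [fF /set0Pn[x xF] dF]] := left_leaky1_fort le_an' ltR gapB'.
apply: (negP (no_fort _ (leaky1_fort_flip fF) _)).
  by apply/set0Pn; exists (flip x); rewrite inE flipK.
rewrite disjoint_subset; apply/subsetP => v vB; rewrite !inE.
by apply: contraTN vB => /(disjointFl dF); rewrite inE flipK => ->.
Qed.

End Grid.

Theorem theorem4p11 (n m : nat) (hn : 1 <= n) (hm : 2 * n ^ 2 <= m) :
  leaky1_number (cart_prod (@path_graph n) (@path_graph m)) = 2 * n.
Proof.
apply/eqP; rewrite eqn_leq; apply/andP; split.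
  have m_gt1 : 1 < m by nia.
  apply: leq_trans (card_end_columns n m).
  exact/leaky1_number_le/end_columns_leaky1_forcing.
have [B forceB <-] :=
  leaky1_number_attained (cart_prod (@path_graph n) (@path_graph m)).
exact: leaky1_forcing_card_ge.
Qed.
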